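(* Let $p$ and $q$ be polynomials in $z$ with complex coefficients, with $n := \deg p \geq 1$ and $m := \deg q \geq 1$, and suppose that $p$ is not a constant multiple of $q$. Let $f:\mathbb{C}\to\mathbb{C}$ be the logharmonic polynomial $f(z) = p(z)\,\overline{q(z)}$. Then the valence of $f$ is at most $n^2 + m^2$; that is, for every $w \in \mathbb{C}$ the number of points $z \in \mathbb{C}$ with $f(z) = w$ is at most $n^2+m^2$.
   Context: A logharmonic polynomial is a function of the form $f(z) = p(z)\overline{q(z)}$ with $p,q$ complex analytic polynomials. The valence refers to the number of (distinct) preimages in $\mathbb{C}$ of a prescribed point $w\in\mathbb{C}$ under $f$; a bound on the valence is a bound valid for every $w \in \mathbb{C}$. *)

(* Defs.v *)
From mathcomp Require Import all_boot all_order all_algebra.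
From mathcomp Require Import complex.
From mathcomp Require Import classical_sets functions cardinality reals.
Set Implicit Arguments.
Unset Strict Implicit.
Unset Printing Implicit Defensive.
Import Order.TTheory GRing.Theory Num.Theory.
Local Open Scope classical_set_scope.
Local Open Scope card_scope.
Local Open Scope ring_scope.
Local Open Scope complex_scope.

(* [deg 0 = 0], as for nonzero constants. *)
Definition deg (K : nzRingType) (p : {poly K}) : nat := (size p).-1.

Definition logharmonic (R : realType) (p q : {poly R[i]}) (z : R[i]) : R[i] :=
  p.[z] * conjc q.[z].

(* [A #<= `I_N] says that A injects into {0, ..., N - 1}; in particular every
   fibre is finite. *)
Definition valence_le (R : realType) (f : R[i] -> R[i]) (N : nat) : Prop :=
  forall w : R[i], f @^-1` [set w] #<= `I_N.

(* Main.v *)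
Require Import Defs.
From mathcomp Require Import all_boot all_order all_algebra.
From mathcomp Require Import complex.
From mathcomp Require Import classical_sets functions cardinality reals.
Import Order.TTheory GRing.Theory Num.Theory.
Local Open Scope ring_scope.
Local Open Scope complex_scope.
Set Implicit Arguments.
Unset Strict Implicit.
Unset Printing Implicit Defensive.

(** Write [n] and [m] for the degrees of [p] and [q], and let [A], [B] be the
polynomials obtained by conjugating the coefficients of [q], [p].  A solution
[z] of [p z * conj (q z) = w] gives, with [x = conj z], a solution of the
polynomial system
  [p z * A x = w],   [q z * B x = conj w],
whose second equation is the conjugate of the first.  Eliminating [z] leaves the
resultant [E x], a polynomial in [x].  Its Sylvester matrix has [m] rows with
entries of degree at most [deg A = m] in [x] and [n] rows with entries of degree
at most [deg B = n], so [deg E <= m ^ 2 + n ^ 2].  As conjugation is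
injective and maps every solution to a root of [E], the bound follows once
[E] is nonzero ([root_elim_poly], [size_resultant_le], [card_le_of_roots]).

It remains to see that [E = 0] forces [p] to be a multiple of [q] when [w] is
nonzero.  If [E = 0], then for all but finitely many [x] the system has a
solution [z].  When [x] approaches a root of [A], [p z] tends to infinity, hence
so does [z]; since [p ^ m] and [q ^ n] are both of degree [n * m], the quotient
of [|p z| ^ m] and [|q z| ^ n] stays bounded above and below, hence so does the
quotient of [|A x| ^ m] and [|B x| ^ n].  The same happens at the roots of [B].
Thus [A ^ m] and [B ^ n] divide each other ([fibre_bound],
[dvdp_of_locally_bounded]); comparing degrees, [m ^ 2 = n ^ 2], so [m = n] and
[A], [B] are associate ([eqp_of_fibres]).  Undoing the conjugation, so are [p]
and [q].

For [w = 0] the solutions are the roots of [p * q], at most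
[n + m <= n ^ 2 + m ^ 2] of them. *)

(** * Growth of polynomials at infinity *)

(** Once [|z| >= 2 |a|], each factor satisfies [|z| / 2 <= |z - a| <= 2 |z|]. *)
Lemma monic_prod_growth (F : numFieldType) (r : seq F) :
  exists2 M : F, 0 <= M & forall z, M <= `|z| ->
    (`|z| / 2) ^+ size r <= `|(\prod_(a <- r) ('X - a%:P)).[z]|
      <= (2 * `|z|) ^+ size r.
Proof.
elim: r => [|a r [M M0 HM]].
  by exists 0 => // z _; rewrite big_nil hornerC normr1 lexx.
exists (M + 2 * `|a|) => [|z hz]; first by rewrite addr_ge0 ?mulr_ge0.
have az : 2 * `|a| <= `|z| by apply: le_trans hz; rewrite lerDr.
have Mz : M <= `|z| by apply: le_trans hz; rewrite lerDl mulr_ge0.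
have /andP[lo up] := HM z Mz.
have a2 : `|a| <= `|z| / 2 by rewrite ler_pdivlMr ?ltr0n // mulrC.
have z2 : `|z| / 2 <= `|z| by rewrite ler_pdivrMr ?ltr0n // ler_peMr // ler1n.
have lo1 : `|z| / 2 <= `|z - a|.
  apply: le_trans (lerB_dist _ _).
  by rewrite lerBrDr [leRHS](splitr `|z|) lerD2l.
have up1 : `|z - a| <= 2 * `|z|.
  apply: le_trans (ler_normB _ _) _.
  by rewrite mulr_natl mulr2n lerD2l (le_trans a2).
rewrite big_cons hornerM hornerXsubC normrM /= !exprS.
by rewrite !ler_pM // ?exprn_ge0 ?divr_ge0.
Qed.

(** [q ^ deg p] and [p ^ deg q] have the same degree, so both are comparable to
the same power of [|z|] at infinity. *)
Lemma poly_growth_le (F : numClosedFieldType) (p q : {poly F}) :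
  p != 0 -> q != 0 ->
  exists K M : F, [/\ 0 <= K, 0 <= M & forall z, M <= `|z| ->
    `|q.[z]| ^+ deg p <= K * `|p.[z]| ^+ deg q].
Proof.
rewrite -(lead_coef_eq0 p) -(lead_coef_eq0 q) => lp0 lq0.
have [r Ep] := closed_field_poly_normal p.
have [s Eq] := closed_field_poly_normal q.
have [M M0 HM] := monic_prod_growth r; have [N N0 HN] := monic_prod_growth s.
have dp : deg p = size r by rewrite /deg Ep size_scale // size_prod_XsubC.
have dq : deg q = size s by rewrite /deg Eq size_scale // size_prod_XsubC.
set lp := lead_coef p in lp0 Ep; set lq := lead_coef q in lq0 Eq.
(* The factor 4 is the ratio of the bounds [2 |z|] and [|z| / 2]. *)
exists (`|lq| ^+ deg p * 4 ^+ (deg q * deg p) / `|lp| ^+ deg q), (M + N).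
split=> [||z hz]; rewrite ?addr_ge0 // ?divr_ge0 ?mulr_ge0 ?exprn_ge0 //.
have Mz : M <= `|z| by apply: le_trans hz; rewrite lerDl.
have Nz : N <= `|z| by apply: le_trans hz; rewrite lerDr.
have /andP[lo _] := HM z Mz; have /andP[_ up] := HN z Nz.
rewrite dp dq Ep Eq !hornerZ !normrM !exprMn.
set P := `|(\prod_(a <- r) _).[z]| in lo *.
set Q := `|(\prod_(a <- s) _).[z]| in up *.
have lps : `|lp| ^+ size s != 0 by rewrite expf_neq0 // normr_eq0.
rewrite -!mulrA mulKf // ler_wpM2l ?exprn_ge0 //.
have P0 : 0 <= P by exact: normr_ge0.
have Q0 : 0 <= Q by exact: normr_ge0.
have {}up : Q ^+ size r <= (2 * `|z|) ^+ size s ^+ size r.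
  by rewrite lerXn2r ?nnegrE ?exprn_ge0 ?mulr_ge0.
have {}lo : (`|z| / 2) ^+ size r ^+ size s <= P ^+ size s.
  by rewrite lerXn2r ?nnegrE ?exprn_ge0 ?divr_ge0.
apply: le_trans up _; rewrite -ler_pdivrMl ?exprn_gt0 ?ltr0n //.
apply: le_trans lo.
rewrite -!exprM [(size r * _)%N]mulnC ler_pdivrMl ?exprn_gt0 ?ltr0n // -exprMn.
suff -> : 2 * `|z| = 4 * (`|z| / 2) by [].
by rewrite mulrA mulrAC -[4]/(2 * 2)%N%:R natrM mulfK ?pnatr_eq0.
Qed.

(** * Comparison of two polynomials through a common fibre point *)

(** The bound does not depend on the location of [z].  If [|z|] is large, the
growth of [q] against [p] transfers to [A] against [B] through the two
equations; if [|z|] is bounded, so is [|q z|], and [q z * B x = v] keeps [|B x|]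
away from [0] while [|A x|] is bounded on the disc. *)
Lemma fibre_bound (F : numClosedFieldType) (p q A B : {poly F}) (w v b : F) :
  p != 0 -> q != 0 -> v != 0 ->
  exists2 C, 0 <= C & forall x z, `|x| <= b ->
    p.[z] * A.[x] = w -> q.[z] * B.[x] = v ->
    `|A.[x]| ^+ deg q <= C * `|B.[x]| ^+ deg p.
Proof.
move=> p0 q0 v0; set m := deg q; set n := deg p.
have [K [M [K0 M0 HK]]] := poly_growth_le p0 q0.
have [U HU] := poly_disk_bound q M; have [S HS] := poly_disk_bound A b.
have vn : 0 < `|v| ^+ n by rewrite exprn_gt0 ?normr_gt0.
have U0 : 0 <= U by apply: le_trans (HU 0 _); rewrite ?normr0.
exists ((K * `|w| ^+ m + `|S| ^+ m * U ^+ n) / `|v| ^+ n).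
  by rewrite divr_ge0 ?addr_ge0 ?mulr_ge0 ?exprn_ge0 // ltW.
move=> x z xb Ew Ev; rewrite mulrAC ler_pdivlMr // mulrDl.
have SA : `|A.[x]| <= `|S|.
  have Ax := HS _ xb; apply: le_trans Ax _.
  by rewrite real_ler_norm // ger0_real // (le_trans _ (HS _ xb)).
have [Mz|zM] := real_leP (ger0_real M0) (normr_real z).
  apply: le_trans (_ : K * `|w| ^+ m * `|B.[x]| ^+ n <= _); last first.
    by rewrite lerDl !mulr_ge0 ?exprn_ge0.
  rewrite -Ew -Ev !normrM !exprMn mulrA ler_wpM2r ?exprn_ge0 //.
  by rewrite mulrA mulrC ler_wpM2r ?exprn_ge0 // HK.
apply: le_trans (_ : `|S| ^+ m * U ^+ n * `|B.[x]| ^+ n <= _); last first.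
  by rewrite lerDr !mulr_ge0 ?exprn_ge0.
rewrite -Ev normrM exprMn mulrA ler_wpM2r ?exprn_ge0 //.
have qU : `|q.[z]| <= U by rewrite HU // ltW.
by rewrite ler_pM ?exprn_ge0 ?lerXn2r ?nnegrE.
Qed.

(** Among the [size D] distinct points [a + e / k.+1], one is not a root of
[D]. *)
Lemma nonroot_near (F : numFieldType) (D : {poly F}) (a e : F) :
  D != 0 -> 0 < e -> exists x, `|x - a| <= e /\ D.[x] != 0.
Proof.
move=> D0 e0; pose f k : F := a + e / k.+1%:R.
have /allPn[x] : ~~ all (root D) (map f (iota 0 (size D))).
  apply/negP => allD.
  suff /(max_poly_roots D0 allD) : uniq (map f (iota 0 (size D))).
    by rewrite size_map size_iota ltnn.
  rewrite map_inj_uniq ?iota_uniq // => i j /addrI.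
  move/(mulfI (lt0r_neq0 e0))/invr_inj/eqP.
  by rewrite eqr_nat => /eqP[].
case/mapP=> k _ -> nr; exists (f k); split=> //.
rewrite /f addrC addKr normrM normfV normr_nat gtr0_norm //.
by rewrite ler_pdivrMr ?ltr0Sn // ler_peMr ?(ltW e0) // ler1n.
Qed.

(** After division by the gcd, a root [a] of the cofactor [B1] of [B] would be a
root of the cofactor [A1] of [A]: the estimate gives [|A1 x| = O(|x - a|)] at
points [x] arbitrarily close to [a].  This contradicts coprimality, so [B1] is
constant. *)
Lemma dvdp_of_locally_bounded (F : numClosedFieldType) (A B D : {poly F}) :
  B != 0 -> D != 0 ->
  (forall b, exists2 C, 0 <= C & forall x, `|x| <= b -> D.[x] != 0 ->
     `|A.[x]| <= C * `|B.[x]|) ->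
  B %| A.
Proof.
move=> B0 D0 bound; pose g := gcdp A B.
have g0 : g != 0 by rewrite gcdp_eq0 negb_and B0 orbT.
have EA := divpK (dvdp_gcdl A B); have EB := divpK (dvdp_gcdr A B).
rewrite -/g in EA EB; set A1 := A %/ g in EA; set B1 := B %/ g in EB.
have cop : coprimep A1 B1 by rewrite coprimep_div_gcd // B0 orbT.
suff sB : size B1 = 1.
  rewrite -EB -EA dvdp_mul2r //.
  by rewrite (eqp_dvdl _ (_ : B1 %= 1)) ?dvd1p // -size_poly_eq1 sB.
apply/eqP/negPn/negP => /closed_rootP[a rB].
have /negP[] : A1.[a] != 0 by apply: coprimep_root rB; rewrite coprimep_sym.
have [B2 EB2] := factor_theorem _ _ rB.
have [A2 EA2] : exists A2, A1 = A1.[a]%:P + A2 * ('X - a%:P).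
  have /factor_theorem[A2 E] : root (A1 - A1.[a]%:P) a.
    by rewrite rootE !hornerE subrr.
  by exists A2; rewrite -E addrC subrK.
have [C C0 HC] := bound (`|a| + 1).
have [U HU] := poly_disk_bound B2 (`|a| + 1).
have [V HV] := poly_disk_bound A2 (`|a| + 1).
have aa : `|a| <= `|a| + 1 by rewrite lerDl.
have U0 : 0 <= U := le_trans (normr_ge0 _) (HU a aa).
have V0 : 0 <= V := le_trans (normr_ge0 _) (HV a aa).
have K0 : 0 <= C * U + V by rewrite addr_ge0 ?mulr_ge0.
apply/negPn/negP=> Aa; have nA : 0 < `|A1.[a]| by rewrite normr_gt0.
have L0 : 0 < C * U + V + (`|A1.[a]| + 1) by rewrite ltr_wpDl // addr_gt0.
(* With [K = C * U + V], the estimate below reads [|A1 a| <= K e]; this [e]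
   makes [K e < |A1 a|] and satisfies [e <= 1], which keeps [x] in the disc. *)
pose e := `|A1.[a]| / (C * U + V + (`|A1.[a]| + 1)).
have e0 : 0 < e by rewrite divr_gt0.
have [x [xa]] := nonroot_near a (mulf_neq0 D0 g0) e0.
rewrite hornerM mulf_eq0 negb_or => /andP[Dx gx].
have e1 : e <= 1.
  by rewrite ler_pdivrMr // mul1r addrCA lerDl addr_ge0 // ltW.
have xb : `|x| <= `|a| + 1.
  rewrite -(subrK a x) addrC (le_trans (ler_normD _ _)) // lerD2l.
  exact: le_trans xa e1.
have := HC x xb Dx; rewrite -EA -EB !hornerM !normrM mulrA.
rewrite ler_pM2r ?normr_gt0 // EB2 hornerM hornerXsubC normrM mulrA => AB.
have : `|A1.[a]| <= (C * U + V) * e.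
  have -> : A1.[a] = A1.[x] - A2.[x] * (x - a).
    by rewrite {2}EA2 !hornerE addrK.
  apply: le_trans (ler_normB _ _) _; rewrite mulrDl lerD //.
    by apply: le_trans AB _; rewrite ler_pM ?mulr_ge0 // ler_wpM2l // HU.
  by rewrite normrM ler_pM // HV.
have Ke : 0 <= (C * U + V) * e by rewrite mulr_ge0 // ltW.
apply/negP; rewrite -real_ltNge ?ger0_real //.
rewrite /e mulrCA gtr_pMr // ltr_pdivrMr // mul1r.
by rewrite ltrDl addr_gt0.
Qed.

(** By [fibre_bound], used in both directions, [A ^ deg q] and [B ^ deg p]
divide each other.  Comparing degrees gives [deg q ^ 2 = deg p ^ 2], and the equal
exponents can then be removed. *)
Lemma eqp_of_fibres (F : numClosedFieldType) (p q A B D : {poly F}) (w v : F) :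
  p != 0 -> q != 0 -> A != 0 -> B != 0 -> D != 0 -> w != 0 -> v != 0 ->
  (0 < deg p)%N ->
  deg A = deg q -> deg B = deg p ->
  (forall x, D.[x] != 0 -> exists z, p.[z] * A.[x] = w /\ q.[z] * B.[x] = v) ->
  A %= B.
Proof.
move=> p0 q0 A0 B0 D0 w0 v0 dp0 dA dB fib.
have AB : B ^+ deg p %| A ^+ deg q.
  apply: (@dvdp_of_locally_bounded _ _ _ D); rewrite ?expf_neq0 // => b.
  have [C C0 HC] := fibre_bound A B w b p0 q0 v0.
  exists C => // x xb /fib[z [Ew Ev]].
  by rewrite !horner_exp !normrX (HC x z).
have BA : A ^+ deg q %| B ^+ deg p.
  apply: (@dvdp_of_locally_bounded _ _ _ D); rewrite ?expf_neq0 // => b.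
  have [C C0 HC] := fibre_bound B A v b q0 p0 w0.
  exists C => // x xb /fib[z [Ew Ev]].
  by rewrite !horner_exp !normrX (HC x z).
have EAB : A ^+ deg q %= B ^+ deg p by rewrite /eqp BA AB.
have pq : deg p = deg q.
  have := congr1 predn (eqp_size EAB).
  rewrite !size_exp -/(deg A) -/(deg B) dA dB.
  by move/eqP; rewrite !mulnn eqn_sqr => /eqP.
by move: AB BA; rewrite -pq !dvdp_pexp2r // /eqp => -> ->.
Qed.

(** * Elimination of one variable *)

(** Every term of the Leibniz formula takes one entry from each row of the
Sylvester matrix, which has [deg Q] rows of coefficients of [P] and [deg P] rows
of coefficients of [Q]. *)
Lemma size_resultant_le (F : idomainType) (P Q : {poly {poly F}}) (a b : nat) :
  (forall i, size (P`_i)%R <= a.+1)%N -> (forall i, size (Q`_i)%R <= b.+1)%N ->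
  (size (resultant P Q) <= (deg Q * a + deg P * b).+1)%N.
Proof.
move=> Pa Qb; apply: leq_trans (size_sum _ _ _) _.
apply/bigmax_leqP => s _.
rewrite mulr_sign (fun_if (fun u : {poly F} => size u)) size_polyN if_same.
apply: leq_trans (size_poly_prod_leq _ _) _; rewrite card_ord leq_subLR.
rewrite addnS ltnS big_split_ord /=.
have rows d c (f : 'I_d -> {poly F}) :
    (forall i, size (f i) <= c.+1)%N -> (\sum_(i < d) size (f i) <= d * c.+1)%N.
  move=> fc; rewrite -[d in (_ <= d * _)%N]card_ord -sum_nat_const.
  exact: leq_sum.
apply: leq_trans (leq_add (rows _ a _ _) (rows _ b _ _)) _ => [i|i|].
- rewrite Sylvester_mxE; case: split_ordP => k /eqP.
    by rewrite (inj_eq (@lshift_inj _ _)) mulrb; case: ifP; rewrite ?size_poly0.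
  by rewrite eq_lrshift.
- rewrite Sylvester_mxE; case: split_ordP => k /eqP.
    by rewrite eq_rlshift.
  by rewrite mulrb; case: ifP; rewrite ?size_poly0.
by rewrite !mulnS addnACA.
Qed.

(** The variable [z] to be eliminated is the outer one; the coefficients are
polynomials in [x]. *)
Definition fibre_poly (F : idomainType) (p A : {poly F}) (w : F)
  : {poly {poly F}} := A *: map_poly polyC p - w%:P%:P.

Lemma map_fibre_poly (F : idomainType) (p A : {poly F}) (w x : F) :
  map_poly (horner_eval x) (fibre_poly p A w) = A.[x] *: p - w%:P.
Proof.
apply/polyP => i; rewrite coef_map_id0 /fibre_poly /horner_eval ?horner0 //.
rewrite !(coefB, coefZ, coefC, coef_map) /= !hornerE.
by case: eqP; rewrite !hornerE.
Qed.

Lemma coef_fibre_poly_size (F : idomainType) (p A : {poly F}) (w : F) i :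
  (size ((fibre_poly p A w)`_i)%R <= (deg A).+1)%N.
Proof.
rewrite coefB coefZ coefC coef_map /=.
apply: leq_trans (size_polyD _ _) _; rewrite size_polyN geq_max mulrC mul_polyC.
rewrite (leq_trans (size_scale_leq _ _)) ?leqSpred //.
by case: eqP => _; rewrite ?size_poly0 // (leq_trans (size_polyC_leq1 _)).
Qed.

Lemma size_fibre_poly (F : idomainType) (p A : {poly F}) (w : F) :
  A != 0 -> (0 < deg p)%N -> size (fibre_poly p A w) = size p.
Proof.
move=> A0 dp; have p1 : (1 < size p)%N by rewrite -ltn_predRL.
have E : size (A *: map_poly polyC p) = size p.
  by rewrite size_scale // size_map_inj_poly //; apply: polyC_inj.
by rewrite size_polyDl E // size_polyN (leq_ltn_trans (size_polyC_leq1 _)).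
Qed.

Lemma lead_coef_fibre_poly (F : idomainType) (p A : {poly F}) (w : F) :
  A != 0 -> (0 < deg p)%N -> lead_coef (fibre_poly p A w) = lead_coef p *: A.
Proof.
move=> A0 dp; have p1 : (1 < size p)%N by rewrite -ltn_predRL.
rewrite lead_coefE size_fibre_poly // /fibre_poly coefB coefZ coefC coef_map /=.
by rewrite -[(size p).-1 == 0]negbK -lt0n dp subr0 mulrC mul_polyC.
Qed.

Definition elim_poly (F : idomainType) (p q A B : {poly F}) (w v : F)
  : {poly F} :=
  resultant (fibre_poly p A w) (fibre_poly q B v).

(** Away from the roots of [A] and [B] the leading coefficients in [z] survive
specialization at [x], so the resultant specializes to that of two polynomials
in [z], which vanishes exactly when these have a common root. *)
Lemma root_elim_poly (F : closedFieldType) (p q A B : {poly F}) (w v x : F) :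
  (0 < deg p)%N -> (0 < deg q)%N -> A.[x] != 0 -> B.[x] != 0 ->
  root (elim_poly p q A B w v) x <->
  exists z, p.[z] * A.[x] = w /\ q.[z] * B.[x] = v.
Proof.
move=> dp dq Ax Bx.
have nz (C : {poly F}) : C.[x] != 0 -> C != 0.
  by apply: contraNneq => ->; rewrite horner0.
have lc0 (r : {poly F}) : (0 < deg r)%N -> lead_coef r != 0.
  apply: contraTneq => /eqP; rewrite lead_coef_eq0 => /eqP ->.
  by rewrite /deg size_poly0.
have lcx (r C : {poly F}) u : (0 < deg r)%N -> C.[x] != 0 ->
    horner_eval x (lead_coef (fibre_poly r C u)) != 0.
  move=> dr Cx; rewrite lead_coef_fibre_poly ?nz // /horner_eval hornerZ.
  by rewrite mulf_neq0 ?lc0.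
have zP (r C : {poly F}) u z :
    root (C.[x] *: r - u%:P) z = (r.[z] * C.[x] == u).
  by rewrite rootE !hornerE mulrC subr_eq0.
have -> : root (elim_poly p q A B w v) x =
    (horner_eval x (resultant (fibre_poly p A w) (fibre_poly q B v)) == 0) by [].
rewrite (map_resultant (lcx p A w dp Ax) (lcx q B v dq Bx)).
rewrite !map_fibre_poly resultant_eq0; split.
  move=> sg.
  have /closed_rootP[z] :
      size (gcdp (A.[x] *: p - w%:P) (B.[x] *: q - v%:P)) != 1%N.
    by rewrite neq_ltn sg orbT.
  by rewrite root_gcd !zP => /andP[/eqP ? /eqP ?]; exists z.
case=> z [/eqP zp /eqP zq].
have rg : root (gcdp (A.[x] *: p - w%:P) (B.[x] *: q - v%:P)) z.
  by rewrite root_gcd !zP zp.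
rewrite ltnNge; apply/negP => /size1_polyC Eg; move: rg.
rewrite Eg rootC -polyC_eq0 -Eg gcdp_eq0 => /andP[/eqP P0 _].
have := size_poly0 F; rewrite -P0.
have p1 : (1 < size p)%N by rewrite -ltn_predRL.
rewrite size_polyDl ?size_scale // ?size_polyN; last first.
  exact: leq_ltn_trans (size_polyC_leq1 _) p1.
by move=> p00; rewrite p00 in p1.
Qed.

(** * Counting solutions *)

Lemma card_le_of_roots (F : closedFieldType) (T : Type) (D : {poly F})
    (g : T -> F) (S : set T) N :
  D != 0 -> injective g -> (forall z, S z -> root D (g z)) -> (deg D <= N)%N ->
  (S #<= `I_N)%card.
Proof.
move=> D0 ginj Sroot DN; have [r ED] := closed_field_poly_normal D.
have lD : lead_coef D != 0 by rewrite lead_coef_eq0.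
have dD : deg D = size r by rewrite /deg ED size_scale // size_prod_XsubC.
have Sr z : S z -> g z \in r.
  by move/Sroot; rewrite ED rootZ // root_prod_XsubC.
pose f z := index (g z) r.
have finj : {in S &, injective f}.
  move=> x y /set_mem/Sr xr /set_mem/Sr yr /(congr1 (nth 0 r)).
  by rewrite !nth_index // => /ginj.
rewrite -(card_le_eql (inj_card_eq finj)) subset_card_le // => _ [z Sz <-] /=.
by rewrite (leq_trans _ DN) // dD index_mem Sr.
Qed.

Unset Implicit Arguments.

Theorem theorem1p5 (R : realType) (p q : {poly R[i]})
    (hp : (1 <= deg p)%N) (hq : (1 <= deg q)%N)
    (hpq : ~ exists c : R[i], p = c *: q) :
  valence_le (logharmonic p q) (deg p ^ 2 + deg q ^ 2)%N.
Proof.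
have nz (r : {poly R[i]}) : (1 <= deg r)%N -> r != 0.
  by apply: contraTneq => ->; rewrite /deg size_poly0.
have p0 := nz p hp; have q0 := nz q hq.
move=> w; have [w0|w0] := eqVneq w 0.
  apply: (@card_le_of_roots _ _ (p * q) id) => //; rewrite ?mulf_neq0 //.
    move=> z /= /eqP; rewrite w0 mulf_eq0 conjc_eq0 => pqz.
    by rewrite rootM.
  rewrite {1}/deg size_mul // -!mulnn.
  have -> : (size p + size q).-2 = (deg p + deg q)%N.
    by rewrite [size p]polySpred // [size q]polySpred // addSn addnS.
  by rewrite leq_add // leq_pmull.
pose A := map_poly conjc q; pose B := map_poly conjc p.
have dA : deg A = deg q by rewrite /deg size_map_poly.
have dB : deg B = deg p by rewrite /deg size_map_poly.
have A0 : A != 0 by rewrite nz // dA.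
have B0 : B != 0 by rewrite nz // dB.
have w'0 : conjc w != 0 by rewrite conjc_eq0.
have vA z : A.[conjc z] = conjc q.[z] by rewrite horner_map.
have vB z : B.[conjc z] = conjc p.[z] by rewrite horner_map.
apply: (@card_le_of_roots _ _ (elim_poly p q A B w (conjc w)) conjc).
- apply/negP => /eqP E0; apply: hpq.
  have : A %= B.
    apply: (@eqp_of_fibres _ p q A B (A * B) w (conjc w)) => //.
      by rewrite mulf_neq0.
    move=> x; rewrite hornerM mulf_eq0 negb_or => /andP[Ax Bx].
    by apply/root_elim_poly => //; rewrite E0 root0.
  rewrite eqp_map => /eqpP[[c d] /= /andP[c0 d0] E].
  exists (d^-1 * c); rewrite -scalerA E scalerA mulVf ?scale1r //.
- exact: can_inj (@conjcK _).
- move=> z /= Ez.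
  have : p.[z] * conjc q.[z] != 0 by rewrite [_ * _]Ez.
  rewrite mulf_eq0 negb_or => /andP[pz qz].
  have Ax : A.[conjc z] != 0 by rewrite vA.
  have Bx : B.[conjc z] != 0 by rewrite vB conjc_eq0.
  apply/(root_elim_poly _ _ hp hq Ax Bx); exists z; split; first by rewrite vA.
  by rewrite vB -[w]Ez rmorphM /= conjcK mulrC.
- have := size_resultant_le (coef_fibre_poly_size p A w)
    (coef_fibre_poly_size q B (conjc w)).
  have dP r C u : C != 0 -> (0 < deg r)%N -> deg (fibre_poly r C u) = deg r.
    by move=> C0 dr; rewrite /deg size_fibre_poly.
  by rewrite !dP // dA dB !mulnn addnC => /(leq_sub2r 1); rewrite !subn1.
Qed.
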